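(* $C(12,6,4) = 41$. That is, there is no $4$-$(12,6,1)$ covering with $40$ blocks.
   Context: Let $v \ge k \ge t \ge 1$ and let $X$ be a set of $v$ points. A $t$-$(v,k,1)$ covering is a pair $(X,\mathcal{B})$ where $\mathcal{B}$ is a set of $k$-subsets of $X$ (called blocks) such that every $t$-subset of $X$ is contained in at least one block of $\mathcal{B}$. The covering number $C(v,k,t)$ is the minimum number of blocks in a $t$-$(v,k,1)$ covering. *)

(* Defs.v *)
From mathcomp Require Import all_boot.

Set Implicit Arguments.
Unset Strict Implicit.
Unset Printing Implicit Defensive.

(* (X, B) is a t-(v,k,1) covering; the point set X is a whole finite type. *)
Definition is_covering (v k t : nat) (X : finType) (B : {set {set X}}) : bool :=
  [&& #|X| == v,
      [forall b in B, #|b| == k] &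
      [forall T : {set X}, (#|T| == t) ==> [exists b in B, T \subset b]]].

Definition k_subsets (k : nat) (X : finType) : {set {set X}} :=
  [set b : {set X} | #|b| == k].

(* The minimum is taken over coverings on the point set 'I_v. The candidate
   k_subsets k 'I_v required by [arg min] is a covering when t <= k <= v (see
   k_subsets_covering); outside that range the value is meaningless. By
   covering_number_le the choice of the v-set is immaterial. *)
Definition covering_number (v k t : nat) : nat :=
  #|[arg min_(B < k_subsets k 'I_v | is_covering v k t B) #|B|]|.

Lemma k_subsets_covering (v k t : nat) (X : finType) :
  t <= k <= v -> #|X| = v -> is_covering v k t (k_subsets k X).
Proof.
move=> /andP[le_tk le_kv] cX; apply/and3P; split; first exact/eqP.
  by apply/forall_inP => b; rewrite inE.
apply/forallP => T; apply/implyP => /eqP cT; apply/exists_inP.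
have le_n : k - t <= #|~: T| by rewrite cardsCs setCK cX cT leq_sub2r.
have /card_gt0P[S] : 0 < #|[set S : {set X} | S \subset ~: T & #|S| == k - t]|.
  by rewrite cards_draws bin_gt0.
rewrite inE => /andP[sST /eqP cS].
exists (T :|: S); last exact: subsetUl.
rewrite inE cardsU cT cS; have -> : T :&: S = set0.
  by apply/eqP; rewrite setI_eq0 disjoint_sym disjoints_subset.
by rewrite cards0 subn0 subnKC.
Qed.

Lemma covering_number_attained (v k t : nat) : t <= k <= v ->
  exists2 B : {set {set 'I_v}}, is_covering v k t B & #|B| = covering_number v k t.
Proof.
move=> h; rewrite /covering_number; case: arg_minnP => [|B cB _].
  by apply: k_subsets_covering; rewrite ?card_ord.
by exists B.
Qed.

Lemma covering_number_le (v k t : nat) (X : finType) (B : {set {set X}}) :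
  t <= k <= v -> is_covering v k t B -> covering_number v k t <= #|B|.
Proof.
move=> h /and3P[/eqP cX /forall_inP Bk /forallP Bt].
rewrite /covering_number; case: arg_minnP => [|B0 _ minB0].
  by apply: k_subsets_covering; rewrite ?card_ord.
pose f (x : X) : 'I_v := cast_ord cX (enum_rank x).
pose g (i : 'I_v) : X := enum_val (cast_ord (esym cX) i).
have fK : cancel f g by move=> x; rewrite /f /g cast_ordK enum_rankK.
have gK : cancel g f by move=> i; rewrite /f /g enum_valK cast_ordKV.
apply: leq_trans (leq_imset_card (fun b : {set X} => f @: b) B).
apply: minB0; apply/and3P; split; first by rewrite card_ord.
  apply/forall_inP => _ /imsetP[b Bb ->].
  by rewrite card_imset ?Bk //; apply: can_inj fK.
apply/forallP => T; apply/implyP => /eqP cT.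
have /implyP := Bt (g @: T); rewrite card_imset ?cT ?eqxx; last exact: can_inj gK.
case/(_ isT)/exists_inP => b Bb sTb; apply/exists_inP.
exists (f @: b); first exact: imset_f.
apply/subsetP => i iT; apply/imsetP; exists (g i); last by rewrite gK.
by apply: (subsetP sTb); apply: imset_f.
Qed.

(* Main.v *)
(** In a covering with at most 40 blocks, counting shows that every point x lies
    on exactly 20 blocks and has a unique partner x' such that 10 blocks contain
    x and x', while any other pair lies on exactly 9 blocks. The 9 blocks on
    such a pair form a 2-(10,4,1) covering, of which there are four up to
    isomorphism. Three of these, and in the last one all but two positions of
    x', cannot be extended to the 20 blocks through x; what remains says that a
    block containing x, x' and y also contains y'. Therefore a block is either a
    union of three partner pairs or meets each of the six pairs in one point.
    The blocks of the second kind form a binary covering array of strength 4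
    with 6 columns in which any two columns show each pattern exactly 5 times,
    and such an array does not exist. *)

(* Averaging alone stops too early: a triple lies on at least 3 blocks, and 10 * 3 <= 4 * 8 still
   allows a pair on only 8. Excluding 8 is the first use of the classification. Its second use is a
   cap: in the four coverings every point has degree at most 4, so a triple lies on at most four
   blocks, and this cap in turn forces exactly four blocks on x, x' and y. These local counts are
   what keeps the extension search small. A partial set of blocks through x is dropped as soon as
   some pair or point has no room left for what must still be covered, and the few branches that
   survive are stored as trees to be replayed. *)
Require Import Defs.
From mathcomp Require Import all_boot.
From mathcomp Require Import zify.

Set Implicit Arguments.
Unset Strict Implicit.
Unset Printing Implicit Defensive.

(** ** Extending a partial family of blocks *)

(* A block is encoded by its mask: its incidence bits along a list of labelled
   points. *)
Definition incl (s : seq nat) (m : seq bool) := all (nth false m) s.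

Fixpoint words (n k : nat) : seq (seq bool) :=
  if n is n'.+1 then
    (if k is k'.+1 then map (cons true) (words n' k') else [::])
      ++ map (cons false) (words n' k)
  else if k is 0 then [:: [::]] else [::].

Fixpoint ceil3 n := if n is n'.+3 then (ceil3 n').+1 else (n != 0 : nat).

Definition through (K : seq (seq bool)) i j := count (incl [:: i; j]) K.

Definition unmet (K : seq (seq bool)) i j :=
  let L := [seq m <- K | incl [:: i; j] m] in
  count (fun z => [&& z != i, z != j & ~~ has (fun m => nth false m z) L])
    (iota 0 11).

(* Lower bound for the number of blocks through the points i and j in the
   complement of K, within the 20 blocks on x (with x deleted): 11 points, of
   which s is the partner of x, and at most 4 blocks through every pair. *)
Definition need (K : seq (seq bool)) s i j :=
  maxn (ceil3 (unmet K i j))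
    (if (i == s) || (j == s) then 4 - through K i j else 0).

(** A pair has room for 4 - [through] more blocks with three further points each; 12 is 4 * 3. *)
Definition overfull_pair K i j := 12 < unmet K i j + 3 * through K i j.

(** A block on [i] uses four of the pairs on [i], so the degree [9 + (i == s)] fixes a budget: [K]
    has spent 4 for each of its blocks on [i], and [need] bounds from below what the missing blocks
    must spend. *)
Definition overfull_point K s i :=
  4 * (9 + (i == s)) <
  4 * count (nth false ^~ i) K +
    sumn [seq need K s i j | j <- iota 0 11 & j != i].

(** Adding [m] changes the counts only at its own points, so testing these is enough. *)
Definition overfull K s (m : seq bool) :=
  let D := [seq i <- iota 0 11 | nth false m i] in
  has (fun i => has (fun j => (i < j) && overfull_pair (m :: K) i j) D) D
  || has (overfull_point (m :: K) s) D.

(* [Branch i j k ts]: some block contains i, j and k, and [ts] refutes each of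
   the choices for it that survive [overfull]. *)
Inductive tree := Branch of nat & nat & nat & seq tree.

(** [all2] also fails on lists of different lengths, so every surviving candidate must have its own
    subtree. The fuel avoids recursion through the nested lists of trees; running out of it counts
    as no refutation. *)
Fixpoint refute (s fuel : nat) (W K : seq (seq bool)) (t : tree) : bool :=
  if fuel is fuel'.+1 then
    let: Branch i j k ts := t in
    [&& i < 11, j < 11, k < 11, uniq [:: i; j; k],
       ~~ has (incl [:: i; j; k]) K &
    let C := [seq m <- W | incl [:: i; j; k] m && ~~ overfull K s m] in
    all2 (fun m t' => refute s fuel' W (m :: K) t') C ts]
  else false.

Definition mask_of (n : nat) (s : seq nat) : seq bool := [seq i \in s | i <- iota 0 n].

(* The four 2-(10,4,1) coverings with 9 blocks, up to isomorphism. In the third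
   one no block separates the points 8 and 9. *)
Definition canon (t : nat) : seq (seq nat) :=
  nth [::] [::
   [:: [:: 0; 1; 4; 5]; [:: 2; 3; 4; 5]; [:: 0; 2; 6; 7]; [:: 1; 3; 6; 7]; [:: 4; 5; 6;
     7]; [:: 1; 2; 8; 9]; [:: 0; 3; 8; 9]; [:: 4; 5; 8; 9]; [:: 6; 7; 8; 9]];
   [:: [:: 0; 1; 4; 5]; [:: 2; 3; 4; 5]; [:: 0; 2; 6; 7]; [:: 1; 3; 6; 7]; [:: 4; 5; 6;
     7]; [:: 1; 2; 8; 9]; [:: 0; 3; 8; 9]; [:: 4; 6; 8; 9]; [:: 5; 7; 8; 9]];
   [:: [:: 0; 1; 2; 3]; [:: 0; 4; 5; 6]; [:: 1; 4; 5; 7]; [:: 2; 4; 6; 7]; [:: 3; 5; 6;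
     7]; [:: 3; 4; 8; 9]; [:: 2; 5; 8; 9]; [:: 1; 6; 8; 9]; [:: 0; 7; 8; 9]];
   [:: [:: 0; 1; 4; 5]; [:: 2; 3; 4; 5]; [:: 4; 5; 6; 7]; [:: 0; 2; 6; 8]; [:: 1; 3; 6;
     8]; [:: 1; 2; 7; 9]; [:: 0; 3; 7; 9]; [:: 4; 6; 8; 9]; [:: 5; 7; 8; 9]]] t.

Lemma ceil3_le n c : n <= 3 * c -> ceil3 n <= c.
Proof.
elim/ltn_ind: n c => -[|[|[|n]]] IH c //= h; try lia.
case: c h => [|c] h; first lia.
by apply: IH; lia.
Qed.

Lemma words_mem m : m \in words (size m) (count id m).
Proof.
elim: m => [|[] m IH] //=; rewrite ?add1n ?add0n mem_cat.
  by rewrite map_f.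
by rewrite (map_f (cons false) IH) orbT.
Qed.

Lemma count_nth_iota m n : size m = n -> count (nth false m) (iota 0 n) = count id m.
Proof.
move=> <-; have := map_nth_iota0 false (leqnn (size m)); rewrite take_size => {3}<-.
by rewrite count_map.
Qed.

Lemma count_neq (T : eqType) (P : pred T) x s :
  uniq s -> x \in s -> P x -> count P s = (count [pred z | (z != x) && P z] s).+1.
Proof.
move=> us xs Px; rewrite -!sum1_count big_mkcond (bigD1_seq x) //= Px add1n.
by rewrite [in RHS]big_mkcondr.
Qed.

Lemma exchange_count (S T : Type) (r : S -> T -> bool) (s : seq S) (t : seq T) :
  \sum_(x <- s) count (r x) t = \sum_(y <- t) count (r^~ y) s.
Proof.
under eq_bigr do rewrite -sum1_count big_mkcond /=.
by rewrite exchange_big /=; apply: eq_bigr => y _; rewrite -sum1_count [RHS]big_mkcond.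
Qed.

Section Refutation.

Variables (s : nat) (M : seq (seq bool)).
Hypothesis sizeM : {in M, forall m, size m = 11 /\ count id m = 5}.
Hypothesis coverM : forall i j k, i < 11 -> j < 11 -> k < 11 ->
  uniq [:: i; j; k] -> has (incl [:: i; j; k]) M.
Hypothesis throughM : forall i j, i < 11 -> j < 11 -> i != j -> through M i j <= 4.
Hypothesis degM : forall i, i < 11 -> count (nth false ^~ i) M <= 9 + (i == s).
Hypothesis specialM : forall i, i < 11 -> i != s -> 4 <= through M s i.

Lemma throughC K i j : through K i j = through K j i.
Proof. by apply: eq_count => m; rewrite /incl /= andbCA. Qed.

Lemma through_perm K R i j : perm_eq M (K ++ R) ->
  through M i j = through K i j + through R i j.
Proof. by move=> /permP pM; rewrite /through pM count_cat. Qed.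

Lemma count_rest2 m i j : m \in M -> i < 11 -> j < 11 -> i != j -> incl [:: i; j] m ->
  count [pred z | [&& z != i, z != j & nth false m z]] (iota 0 11) = 3.
Proof.
move=> /sizeM[sm cm] lti ltj ne /and3P[mi mj _].
have := count_nth_iota sm; rewrite cm.
have -> := @count_neq _ (nth false m) i (iota 0 11) (iota_uniq _ _) _ mi; last by
  rewrite mem_iota.
have -> := @count_neq _ [pred z | (z != i) && nth false m z] j (iota 0 11) (iota_uniq _
  _).
- by move=> /succn_inj/succn_inj e; apply: (etrans _ e); apply: eq_count => z /=;
  rewrite andbCA.
- by rewrite mem_iota.
by rewrite /= eq_sym ne.
Qed.

(** Every unmet point shares a block of [R] with [i] and [j], and such a block has only three
    further points. *)
Lemma unmet_le K R i j : perm_eq M (K ++ R) -> i < 11 -> j < 11 -> i != j ->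
  unmet K i j <= 3 * through R i j.
Proof.
move=> pM lti ltj ne; rewrite /unmet.
set P := (X in count X).
apply: (@leq_trans (\sum_(z <- iota 0 11) count (fun m => P z && incl [:: i; j; z] m)
  R)).
  rewrite -sum1_count big_mkcond !big_seq; apply: leq_sum => z.
  rewrite mem_iota => /andP[_ ltz]; case: ifP => // Pz; rewrite -has_count.
  case/and3P: (Pz) => zi zj nK.
  have /hasP[m mM mz] : has (incl [:: i; j; z]) M.
    by apply: coverM => //; rewrite /= !inE negb_or ne ![_ == z]eq_sym zi zj.
  apply/hasP; exists m => //=.
  move: mM; rewrite (perm_mem pM) mem_cat => /orP[mK|//].
  case/negP: nK; apply/hasP; exists m; last by case/and4P: mz.
  by rewrite mem_filter mK andbT; case/and4P: mz => h1 h2 _ _; rewrite /incl /= h1 h2.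
rewrite (exchange_count (fun z m => P z && incl [:: i; j; z] m)).
rewrite /through -sum1_count big_distrr [X in _ <= X]big_mkcond !big_seq.
apply: leq_sum => m mR.
have mM : m \in M by rewrite (perm_mem pM) mem_cat mR orbT.
case: ifP => mij.
  rewrite [X in _ <= X](muln1 3); apply: leq_trans (eq_leq (count_rest2 mM lti ltj ne
    mij)).
  by apply: sub_count => z /= /andP[/and3P[-> -> _]] /and4P[].
rewrite leqn0; apply/eqP/(eq_trans _ (count_pred0 (iota 0 11))); apply: eq_count => z
  /=.
apply: contraFF mij => /andP[_ /and4P[mi mj _ _]].
by rewrite /incl /= mi mj.
Qed.

Lemma need_le K R i j : perm_eq M (K ++ R) -> i < 11 -> j < 11 -> i != j ->
  need K s i j <= through R i j.
Proof.
move=> pM lti ltj ne; rewrite /need geq_max ceil3_le ?(unmet_le pM) //=.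
case: ifP => // /orP[] /eqP e; subst.
  by have := @specialM j ltj; rewrite eq_sym ne (through_perm _ _ pM) => /(_ isT); lia.
have := @specialM i lti; rewrite ne throughC (through_perm _ _ pM) => /(_ isT); lia.
Qed.

Lemma sum_through R i : {subset R <= M} -> i < 11 ->
  \sum_(j <- iota 0 11 | j != i) through R i j = 4 * count (nth false ^~ i) R.
Proof.
move=> sR lti; rewrite big_mkcond.
under eq_bigr => j _.
  have -> : (if j != i then through R i j else 0) = count (fun m => (j != i) && incl [::
    i; j] m) R.
    by case: (j != i) => //=; rewrite count_pred0.
  over.
rewrite (exchange_count (fun j m => (j != i) && incl [:: i; j] m)).
rewrite -sum1_count big_distrr [RHS]big_mkcond !big_seq; apply: eq_bigr => m mR.
case/sR/sizeM: mR => sm cm; case: ifP => mi; last first.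
  by apply: eq_trans (count_pred0 (iota 0 11)); apply: eq_count => z /=; rewrite /incl
    /= mi andbF.
have := count_nth_iota sm; rewrite cm.
have -> := @count_neq _ (nth false m) i (iota 0 11) (iota_uniq _ _) _ mi; last by
  rewrite mem_iota.
move=> /succn_inj e; apply: etrans (etrans e (esym (muln1 4))).
by apply: eq_count => z /=; rewrite /incl /= mi andbT.
Qed.

Lemma not_overfull K R m : perm_eq M (K ++ m :: R) -> ~~ overfull K s m.
Proof.
move=> pM0; have pM : perm_eq M ((m :: K) ++ R).
  by apply: perm_trans pM0 _; rewrite -cat1s perm_catCA.
apply/negP => /orP[] /hasP[i]; rewrite mem_filter mem_iota => /and3P[_ _ lti].
  case/hasP => j; rewrite mem_filter mem_iota => /and3P[_ _ ltj] /andP[ltij].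
  have ne : i != j by rewrite neq_ltn ltij.
  have := unmet_le pM lti ltj ne; have := throughM lti ltj ne.
  rewrite (through_perm _ _ pM) /overfull_pair.
  by move: (through _ i j) (through R i j) (unmet _ i j) => a b c; lia.
have := degM lti; move: (permP pM (nth false ^~ i)); rewrite count_cat => ->.
rewrite /overfull_point sumnE big_map big_filter.
have : \sum_(j <- iota 0 11 | j != i) need (m :: K) s i j <= 4 * count (nth false ^~ i)
  R.
  rewrite -sum_through //; last by move=> r rR; rewrite (perm_mem pM) mem_cat rR orbT.
  rewrite big_seq_cond [X in _ <= X]big_seq_cond; apply: leq_sum => j.
  by rewrite mem_iota => /andP[/andP[_ ltj] ji]; apply: need_le; rewrite // eq_sym.
move: (count _ R) (count _ (m :: K)) (\sum_(_ <- _ | _) _) (i == s) => a b c d; lia.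
Qed.

(** The tree is followed along the actual blocks: the triple of a node lies on a block of [M]
    outside [K], which passes the counting tests because it really occurs, and then moves from [R]
    to [K]. *)
Lemma refute_sound W K R n t : perm_eq M (K ++ R) -> {subset R <= W} -> ~~ refute s n W
  K t.
Proof.
elim: n K R t => [|n IH] K R [i j k ts] //= pM sR.
apply/negP => /and5P[lti ltj ltk u] /andP[nK].
have /hasP[m mM mijk] := coverM lti ltj ltk u.
have mR : m \in R.
  move: mM; rewrite (perm_mem pM) mem_cat => /orP[mK|//].
  by case/hasP: nK; exists m.
have pR := perm_to_rem mR.
have pM' : perm_eq M (K ++ m :: rem m R).
  by apply: perm_trans pM _; rewrite perm_cat2l.
set C := (X in all2 _ X).
have mC : m \in C.
  by rewrite mem_filter (sR _ mR) (not_overfull pM') !andbT; case/and4P: mijk => -> ->.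
elim: C ts mC => [//|c C IHC] [|t ts] //=.
rewrite inE => /orP[/eqP <-|mC] /andP[h hs]; last exact: IHC mC hs.
apply/negP: h; apply: (IH _ (rem m R)).
  by apply: perm_trans pM' _; rewrite -cat1s perm_catCA.
by move=> r /mem_rem /sR.
Qed.

End Refutation.

(** ** Classification of the 2-(10,4,1) coverings with 9 blocks *)

Definition mask_diff (u c : seq bool) := [seq p.1 && ~~ p.2 | p <- zip u c].

(* Each mask of the search space covers at most 5 of the pairs still to be
   covered, which prunes the search. *)
Fixpoint cover_search (C : seq (seq bool * seq bool)) (d : nat) (u : seq bool) : seq
  (seq (seq bool)) :=
  if 5 * d < count id u then [::]
  else if d is d'.+1 then
    let k := index true u in
    flatten [seq map (cons c.1) (cover_search C d' (mask_diff u c.2)) | c <- C & nth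
      true c.2 k]
  else [:: [::]].

Lemma nth_mask_diff u c k : size u = size c ->
  nth false (mask_diff u c) k = nth false u k && ~~ nth false c k.
Proof.
move=> e; case: (ltnP k (size u)) => lt.
  by rewrite (nth_map (false, false)) ?size_zip -?e ?minnn // nth_zip.
by rewrite !nth_default // /mask_diff ?size_map ?size_zip -?e ?minnn.
Qed.

Lemma count_mask_diff u c : size u = size c -> count id u <= count id c + count id
  (mask_diff u c).
Proof. by elim: u c => [|x u IH] [|y c] //= [/IH]; rewrite /mask_diff; case: x y => []
  []; lia. Qed.

Lemma size_mask_diff u c : size u = size c -> size (mask_diff u c) = size u.
Proof. by move=> e; rewrite size_map size_zip -e minnn. Qed.

Section Search.

Variables (cv : seq bool -> seq bool) (W : seq (seq bool)) (n : nat).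
Hypothesis cvW : {in W, forall m, size (cv m) = n /\ count id (cv m) <= 5}.

Definition covers (O : seq (seq bool)) u :=
  forall k, nth false u k -> has (fun m => nth false (cv m) k) O.

Lemma covers_rem m O u : size u = n -> {subset O <= W} -> m \in O -> covers O u ->
  covers (rem m O) (mask_diff u (cv m)).
Proof.
move=> su sO mO cO k; have [sm _] := cvW (sO _ mO).
rewrite nth_mask_diff ?sm // => /andP[/cO + nk].
by rewrite (perm_has _ (perm_to_rem mO)) /= (negPf nk).
Qed.

Lemma covers_bound O u : size u = n -> {subset O <= W} -> covers O u -> count id u <= 5
  * size O.
Proof.
elim: O u => [|m O IH] u su sO cO.
  rewrite leqNgt -has_count; apply/negP => /(has_nthP false)[k _ uk].
  by have := cO k uk.
have [sm cm] : size (cv m) = n /\ count id (cv m) <= 5 by apply/cvW/sO/mem_head.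
apply: leq_trans (@count_mask_diff u (cv m) _) _; first by rewrite su.
rewrite /= mulnS leq_add // IH ?size_mask_diff ?su //.
  by move=> r rO; apply: sO; rewrite inE rO orbT.
by have := covers_rem su sO (mem_head _ _) cO; rewrite /= eqxx.
Qed.

(** The search takes the blocks in the order dictated by the first uncovered item, hence [perm_eq]
    instead of equality. *)
Lemma cover_search_sound d u O : size O = d -> size u = n -> {subset O <= W} -> covers O
  u ->
  has (perm_eq O) (cover_search [seq (m, cv m) | m <- W] d u).
Proof.
elim: d u O => [|d IH] u O sO su sOW cO /=; have := covers_bound su sOW cO; rewrite sO
  leqNgt => /negPf ->.
  by move/size0nil: sO => ->.
(* When nothing is left to cover, [index true u] lies past the end and the default [true] admits
   every mask, so surplus blocks are enumerated as well. *)
have [m mO mk] : exists2 m, m \in O & nth true (cv m) (index true u).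
  have [uk|nu] := boolP (true \in u).
    have [|m mO mk] := hasP (cO (index true u) _); first by rewrite nth_index.
    exists m => //; rewrite (set_nth_default false) // (cvW (sOW _ mO)).1 -su.
    by rewrite index_mem.
  case: O sO sOW {cO} => // m O _ sOW; exists m; first exact: mem_head.
  rewrite nth_default // (cvW (sOW _ (mem_head _ _))).1 -su leqNgt index_mem.
  exact: nu.
have [sm _] := cvW (sOW _ mO).
have /hasP[r rS pr] : has (perm_eq (rem m O)) (cover_search [seq (m, cv m) | m <- W] d
  (mask_diff u (cv m))).
  apply: IH; rewrite ?size_mask_diff ?su //; first by rewrite size_rem // sO.
    by move=> r /mem_rem /sOW.
  exact: covers_rem.
apply/hasP; exists (m :: r); last first.
  by apply: perm_trans (perm_to_rem mO) _; rewrite perm_cons.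
apply/flattenP; exists (map (cons m) (cover_search [seq (m, cv m) | m <- W] d (mask_diff
  u (cv m)))); last exact: map_f.
apply/mapP; exists (m, cv m) => //.
by rewrite mem_filter mk /=; apply: map_f; apply: sOW.
Qed.

End Search.

(* Some point lies on only three blocks, which we may assume to be [star_masks];
   the other six blocks have to cover the 27 pairs of [cross]. *)
Definition cross := [seq p <- [seq (i, j) | i <- iota 1 9, j <- iota 1 9] | (p.1).-1 %/
  3 < (p.2).-1 %/ 3].
Definition crosscov (m : seq bool) := [seq incl [:: p.1; p.2] m | p <- cross].

Definition link_masks := [seq false :: m | m <- words 9 4].
Definition star_masks := map (mask_of 10) [:: [:: 0; 1; 2; 3]; [:: 0; 4; 5; 6]; [:: 0;
  7; 8; 9]].
(* Six blocks cover 27 pairs only if one of them covers 5, hence has this shape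
   up to a relabelling that preserves [star_masks]. *)
Definition first_mask := mask_of 10 [:: 1; 2; 4; 7].

(** [sg] lists the old names in the order of the new labels, so relabellings compose by reading one
    list through the other. *)
Definition relabel (sg : seq nat) (m : seq bool) := [seq nth false m i | i <- sg].

Definition isom_canon (M : seq (seq bool)) (e : nat * seq nat) :=
  [&& e.1 < 4, perm_eq e.2 (iota 0 10) &
      perm_eq (map (relabel e.2) M) (map (mask_of 10) (canon e.1))].

(* One isomorphism onto a canonical covering for each solution, in the order in
   which [cover_search] produces them. *)
Definition isomorphisms : seq (nat * seq nat) := [::
(0, [:: 0; 3; 4; 7; 1; 2; 5; 6; 8; 9]);
(1, [:: 0; 3; 4; 7; 1; 2; 5; 6; 8; 9]);
(1, [:: 0; 3; 4; 7; 1; 2; 6; 5; 8; 9]);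
(2, [:: 0; 7; 8; 9; 6; 5; 4; 3; 1; 2]);
(2, [:: 0; 7; 8; 9; 6; 5; 4; 3; 1; 2]);
(1, [:: 0; 6; 9; 3; 4; 5; 7; 8; 1; 2]);
(2, [:: 0; 7; 8; 9; 6; 5; 4; 3; 1; 2]);
(2, [:: 0; 7; 8; 9; 6; 5; 4; 3; 1; 2]);
(1, [:: 0; 5; 8; 3; 4; 6; 7; 9; 1; 2]);
(1, [:: 0; 4; 7; 3; 5; 6; 8; 9; 1; 2]);
(2, [:: 0; 4; 5; 6; 9; 8; 7; 3; 1; 2]);
(3, [:: 0; 3; 5; 8; 1; 2; 4; 7; 6; 9]);
(3, [:: 0; 3; 4; 7; 1; 2; 5; 8; 6; 9]);
(3, [:: 0; 3; 5; 8; 2; 1; 4; 7; 6; 9]);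
(3, [:: 0; 3; 4; 7; 2; 1; 5; 8; 6; 9]);
(2, [:: 0; 7; 8; 9; 5; 6; 4; 3; 1; 2]);
(2, [:: 0; 7; 8; 9; 5; 6; 4; 3; 1; 2]);
(1, [:: 0; 6; 8; 3; 4; 5; 7; 9; 1; 2]);
(2, [:: 0; 7; 8; 9; 5; 6; 4; 3; 1; 2]);
(2, [:: 0; 7; 8; 9; 5; 6; 4; 3; 1; 2]);
(1, [:: 0; 5; 9; 3; 4; 6; 7; 8; 1; 2]);
(1, [:: 0; 4; 7; 3; 5; 6; 9; 8; 1; 2]);
(2, [:: 0; 4; 5; 6; 8; 9; 7; 3; 1; 2]);
(3, [:: 0; 3; 5; 9; 1; 2; 4; 7; 6; 8]);
(3, [:: 0; 3; 4; 7; 1; 2; 5; 9; 6; 8]);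
(3, [:: 0; 3; 5; 9; 2; 1; 4; 7; 6; 8]);
(3, [:: 0; 3; 4; 7; 2; 1; 5; 9; 6; 8]);
(2, [:: 0; 4; 5; 6; 1; 2; 3; 7; 8; 9]);
(3, [:: 0; 3; 6; 9; 1; 2; 4; 7; 5; 8]);
(3, [:: 0; 3; 6; 8; 1; 2; 4; 7; 5; 9]);
(3, [:: 0; 3; 4; 7; 1; 2; 5; 9; 6; 8]);
(3, [:: 0; 3; 4; 7; 1; 2; 6; 9; 5; 8]);
(1, [:: 0; 3; 7; 4; 1; 2; 8; 9; 5; 6]);
(2, [:: 0; 7; 8; 9; 2; 1; 3; 4; 5; 6]);
(3, [:: 0; 3; 4; 7; 1; 2; 5; 8; 6; 9]);
(3, [:: 0; 3; 4; 7; 1; 2; 6; 8; 5; 9]);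
(1, [:: 0; 3; 7; 4; 1; 2; 9; 8; 5; 6]);
(2, [:: 0; 7; 8; 9; 1; 2; 3; 4; 5; 6]);
(3, [:: 0; 3; 6; 9; 2; 1; 4; 7; 5; 8]);
(3, [:: 0; 3; 6; 8; 2; 1; 4; 7; 5; 9]);
(1, [:: 0; 3; 4; 7; 1; 2; 5; 6; 8; 9]);
(3, [:: 0; 3; 4; 7; 2; 1; 6; 8; 5; 9]);
(3, [:: 0; 3; 4; 7; 2; 1; 6; 9; 5; 8]);
(2, [:: 0; 4; 5; 6; 2; 1; 3; 7; 8; 9])].

Lemma isomorphisms_ok :
  all2 (fun r e => isom_canon (star_masks ++ first_mask :: r) e)
    (let C := [seq (m, crosscov m) | m <- link_masks] in cover_search C 5 (map negb
      (crosscov first_mask))) isomorphisms.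
Proof. exact_no_check (erefl true). Qed.

(** Moves a mask with two points in one group and one in each of the others to [first_mask]. Groups
    stay together, so [star_masks] is preserved. *)
Definition normal_order (m : seq bool) : seq nat :=
  let G := [:: [:: 1; 2; 3]; [:: 4; 5; 6]; [:: 7; 8; 9]] in
  let two g := count (nth false m) g == 2 in
  let sort g := [seq i <- g | nth false m i] ++ [seq i <- g | ~~ nth false m i] in
  0 :: flatten (map sort ([seq g <- G | two g] ++ [seq g <- G | ~~ two g])).

(** Four of the nine points split over the three groups as 2+1+1, 2+2 or 3+1, which gives 5, 4 or 3
    cross pairs. *)
Lemma link_masks_ok :
  all (fun m => [&& size (crosscov m) == 27, count id (crosscov m) <= 5 &
     (count id (crosscov m) == 5) ==>
       [&& perm_eq (normal_order m) (iota 0 10), perm_eq (map (relabel (normal_order m))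
         star_masks) star_masks & relabel (normal_order m) m == first_mask]])
    link_masks.
Proof. exact_no_check (erefl true). Qed.

(** At most nine blocks, not exactly nine: this form later yields the lower bound 9 for the blocks
    on a pair. *)
Definition is_link (M : seq (seq bool)) :=
  [/\ size M <= 9, {in M, forall m, size m = 10 /\ count id m = 4} &
      forall i j, i < 10 -> j < 10 -> i != j -> has (incl [:: i; j]) M].

Definition classified M := exists e, isom_canon M e.

Lemma incl_relabel sg m s : all (fun i => i < size sg) s ->
  incl s (relabel sg m) = incl [seq nth 0 sg i | i <- s] m.
Proof.
move=> /allP ls; rewrite /incl all_map; apply: eq_in_all => i /ls lt /=.
by rewrite (nth_map 0).
Qed.

Lemma is_link_relabel sg M : perm_eq sg (iota 0 10) -> is_link M -> is_link (map
  (relabel sg) M).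
Proof.
move=> psg [sM hM cM].
have ssg : size sg = 10 by rewrite (perm_size psg) size_iota.
have usg : uniq sg by rewrite (perm_uniq psg) iota_uniq.
have lsg i : i < 10 -> nth 0 sg i < 10.
  by move=> lt; have := mem_nth 0 (_ : i < size sg); rewrite (perm_mem psg) mem_iota ssg
    => /(_ lt).
split; first by rewrite size_map.
  move=> _ /mapP[m /hM[sm cm] ->]; split; first by rewrite size_map.
  by rewrite /relabel count_map -[RHS]cm -(count_nth_iota sm); apply/permP.
move=> i j lti ltj ne; rewrite has_map.
rewrite (@eq_has _ _ (incl [:: nth 0 sg i; nth 0 sg j])); last first.
  by move=> m; apply: (@incl_relabel sg m [:: i; j]); rewrite /= ssg lti ltj.
by apply: cM; rewrite ?lsg // nth_uniq ?ssg.
Qed.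

Lemma relabel_comp sg ta m : all (fun i => i < size sg) ta ->
  relabel ta (relabel sg m) = relabel [seq nth 0 sg i | i <- ta] m.
Proof.
move=> /allP lta; rewrite /relabel -map_comp; apply/eq_in_map => i /lta lt /=.
by rewrite (nth_map 0).
Qed.

Lemma classified_relabel sg M : perm_eq sg (iota 0 10) ->
  classified (map (relabel sg) M) -> classified M.
Proof.
move=> psg [[t ta] /and3P[]]; rewrite [_.1]/= [_.2]/= => lt pta pM.
have ssg : size sg = 10 by rewrite (perm_size psg) size_iota.
have lta : all (fun i => i < size sg) ta.
  by apply/allP => i; rewrite (perm_mem pta) mem_iota ssg.
exists (t, [seq nth 0 sg i | i <- ta]); rewrite /isom_canon [_.1]/= [_.2]/= lt andTb;
  apply/andP; split.
  apply: perm_trans (perm_map _ pta) _.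
  by apply: perm_trans psg; rewrite -ssg map_nth_iota0 // take_size.
rewrite -map_comp in pM; rewrite -(eq_map (f := relabel ta \o relabel sg)) //.
by move=> m /=; rewrite relabel_comp.
Qed.

Lemma classified_perm M N : perm_eq M N -> classified M -> classified N.
Proof.
move=> pMN [e /and3P[h1 h2 h3]]; exists e; rewrite /isom_canon h1 h2 /=.
by apply: perm_trans h3; rewrite perm_sym perm_map.
Qed.

Lemma perm_iota_subset sg n : {subset iota 0 n <= sg} -> size sg <= n -> perm_eq sg
  (iota 0 n).
Proof.
move=> sub sz; have sz' : size sg <= size (iota 0 n) by rewrite size_iota.
rewrite perm_sym; apply: uniq_perm; rewrite ?iota_uniq //.
  exact: leq_size_uniq (iota_uniq _ _) sub sz'.
exact: (uniq_min_size (iota_uniq _ _) sub sz').2.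
Qed.

Lemma link_masksP m : size m = 10 -> count id m = 4 -> ~~ nth false m 0 -> m \in
  link_masks.
Proof.
by case: m => [//|[] m] //= [sm] cm _; apply: map_f; rewrite -sm -[X in words _ X]cm
  words_mem.
Qed.

(** At most nine blocks of four points give fewer than 4 * 10 incidences, so some point [z] lies on
    at most three blocks. Each of these has three further points and together they reach the other
    nine, so there are exactly three and they split the nine points into groups. *)
Lemma link_star M : is_link M -> exists2 sg, perm_eq sg (iota 0 10) &
  exists2 O, perm_eq (map (relabel sg) M) (star_masks ++ O) & {in O, forall m, ~~ nth
    false m 0}.
Proof.
move=> [sM hM cM].
have [z ltz cz] : exists2 z, z < 10 & count (nth false ^~ z) M <= 3.
  have : ~~ all (fun z => 3 < count (nth false ^~ z) M) (iota 0 10).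
    apply/negP => /allP h.
    have : \sum_(z <- iota 0 10) 4 <= \sum_(z <- iota 0 10) count (nth false ^~ z) M.
      by rewrite !big_seq; apply: leq_sum => z /h.
    rewrite (exchange_count (fun z m => nth false m z)).
    have -> : \sum_(m <- M) count (nth false m) (iota 0 10) = \sum_(m <- M) 4.
      by apply: eq_big_seq => m /hM[sm cm]; rewrite (count_nth_iota sm).
    by rewrite !big_const_seq !iter_addn_0 !count_predT size_iota; lia.
  by rewrite -has_predC => /hasP[z]; rewrite mem_iota /= -leqNgt => ltz cz; exists z.
pose L := [seq m <- M | nth false m z].
pose G (m : seq bool) := [seq i <- iota 0 10 | (i != z) && nth false m i].
have sG m : m \in L -> size (G m) = 3.
  rewrite mem_filter => /andP[mz /hM[sm cm]].
  have := count_nth_iota sm; rewrite cm.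
  have -> := @count_neq _ (nth false m) z (iota 0 10) (iota_uniq _ _) _ mz; last by
    rewrite mem_iota.
  by rewrite size_filter => /succn_inj.
have cG i : i < 10 -> i \in z :: flatten (map G L).
  move=> lti; rewrite inE; case: eqVneq => //= ne.
  have zi : z != i by rewrite eq_sym.
  have /hasP[m mM /and3P[mz mi _]] := cM z i ltz lti zi.
  apply/flattenP; exists (G m); last by rewrite mem_filter ne mi mem_iota.
  by apply: map_f; rewrite mem_filter mz.
have szf : size (flatten (map G L)) = 3 * size L.
  rewrite size_flatten /shape -map_comp sumnE big_map (eq_big_seq (fun=> 3)); last
    exact: sG.
  by rewrite big_const_seq iter_addn_0 count_predT.
have pm : perm_eq (z :: flatten (map G L)) (iota 0 10).
  apply: perm_iota_subset; first by move=> i; rewrite mem_iota => /cG.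
  rewrite /= szf size_filter; move: cz; move: (count _ M) => c; lia.
have sL : size L = 3 by have := perm_size pm; rewrite [size (_ :: _)]/= szf size_iota;
  lia.
case eL : L sL sG pm => [|a [|b [|c [|]]]] //= _ sG; rewrite cats0 => pm.
exists (z :: G a ++ G b ++ G c) => //.
exists (map (relabel (z :: G a ++ G b ++ G c)) [seq m <- M | ~~ nth false m z]); last
  first.
  by move=> n /mapP[m]; rewrite mem_filter => /andP[mz _] ->.
have pML : perm_eq M (L ++ [seq m <- M | ~~ nth false m z]) by rewrite perm_sym
  perm_filterC.
apply: perm_trans (perm_map _ pML) _; rewrite map_cat -[X in perm_eq _ X]/(star_masks ++
  _) perm_cat2r eL.
have u : uniq (z :: G a ++ G b ++ G c) by rewrite (perm_uniq pm).
have Gin m i : i \in G m -> nth false m i by rewrite mem_filter => /andP[/andP[]].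
have Gz m i : i \in G m -> i != z by rewrite mem_filter => /andP[/andP[]].
have Gi m i : i \in G m -> i \in iota 0 10 by rewrite mem_filter => /andP[].
have Gout m n : n \in [:: a; b; c] -> ~~ has [in G m] (G n) -> map (nth false m) (G n) =
  nseq 3 false.
  move=> /sG <- nh; rewrite -(size_map (nth false m)); apply/all_pred1P/allP => _
    /mapP[i is_ ->] /=.
  apply/eqP/negbTE; apply: contra nh => mi; apply/hasP; exists i => //.
  by rewrite /= mem_filter mi (Gz n) // (Gi n).
have Gall m : m \in [:: a; b; c] -> map (nth false m) (G m) = nseq 3 true.
  by move=> /sG <-; rewrite -(size_map (nth false m)); apply/all_pred1P/allP => _
    /mapP[i /Gin -> ->].
have Lz m : m \in [:: a; b; c] -> nth false m z by rewrite -eL mem_filter => /andP[].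
have /and3P[ain bin cin] : [&& a \in [:: a; b; c], b \in [:: a; b; c] & c \in [:: a; b;
  c]].
  by rewrite !inE !eqxx !orbT.
have E m x1 x2 x3 : m \in [:: a; b; c] -> map (nth false m) (G a) = x1 ->
    map (nth false m) (G b) = x2 -> map (nth false m) (G c) = x3 ->
    relabel (z :: G a ++ G b ++ G c) m = true :: x1 ++ x2 ++ x3.
  by move=> mL <- <- <-; rewrite -!map_cat -[LHS]/(nth false m z :: _) Lz.
move: u; rewrite cons_uniq !cat_uniq has_cat negb_or => /and5P[_ _ /andP[ab ac] _
  /andP[bc _]].
have ba := ab; rewrite has_sym in ba; have ca := ac; rewrite has_sym in ca.
have cb := bc; rewrite has_sym in cb.
rewrite -[X in perm_eq X]/[:: relabel _ a; relabel _ b; relabel _ c] (E a _ _ _ ain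
  (Gall _ ain) (Gout _ _ bin ab) (Gout _ _ cin ac)).
rewrite (E b _ _ _ bin (Gout _ _ ain ba) (Gall _ bin) (Gout _ _ cin bc)).
by rewrite (E c _ _ _ cin (Gout _ _ ain ca) (Gout _ _ bin cb) (Gall _ cin)).
Qed.

Lemma crossP p : p \in cross -> [/\ p.1 < 10, p.2 < 10 & p.1 != p.2].
Proof.
rewrite mem_filter => /andP[lt /allpairsP[[i j] []]]; rewrite !mem_iota => /andP[_ hi]
  /andP[_ hj] e.
by move: lt; rewrite e /= => lt; split=> //; apply: contraTneq lt => ->; rewrite ltnn.
Qed.

Lemma star_cross : ~~ has (fun p => has (incl [:: p.1; p.2]) star_masks) cross.
Proof. by []. Qed.

Lemma link_covers M O : is_link M -> perm_eq M (star_masks ++ O) ->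
  covers crosscov O (nseq 27 true).
Proof.
move=> [_ _ cM] pM k; rewrite nth_nseq; case: ifP => // ltk _.
have kx : nth (0, 0) cross k \in cross by apply: mem_nth.
have [h1 h2 ne] := crossP kx.
have /hasP[m mM mk] := cM _ _ h1 h2 ne.
apply/hasP; exists m; last by rewrite (nth_map (0, 0)).
move: mM; rewrite (perm_mem pM) mem_cat => /orP[ms|//].
case/hasP: star_cross; exists (nth (0, 0) cross k) => //.
by apply/hasP; exists m.
Qed.

Lemma link_masks_table m : m \in link_masks -> [/\ size (crosscov m) = 27, count id
  (crosscov m) <= 5 &
  count id (crosscov m) = 5 ->
    [/\ perm_eq (normal_order m) (iota 0 10), perm_eq (map (relabel (normal_order m))
      star_masks) star_masks & relabel (normal_order m) m = first_mask]].
Proof.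
move=> mW; have /and3P[/eqP h1 h2 /implyP h3] := allP link_masks_ok m mW.
by split=> // /eqP/h3/and3P[? ? /eqP].
Qed.

Lemma link_outer_masks M O : is_link M -> perm_eq M (star_masks ++ O) -> {in O, forall
  m, ~~ nth false m 0} ->
  {subset O <= link_masks}.
Proof.
move=> [_ hM _] pM hO m mO; have [] := hM m; first by rewrite (perm_mem pM) mem_cat mO
  orbT.
by move=> sm cm; apply: link_masksP => //; apply: hO.
Qed.

Lemma all2_mem (S T : eqType) (r : S -> T -> bool) s t x :
  all2 r s t -> x \in s -> exists y, r x y.
Proof.
elim: s t => [|a s IH] [|b t] //= /andP[rab /IH h]; rewrite inE => /orP[/eqP->|/h//].
by exists b.
Qed.

Lemma classify_star M O : is_link M -> perm_eq M (star_masks ++ first_mask :: O) ->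
  {in first_mask :: O, forall m, ~~ nth false m 0} -> classified M.
Proof.
move=> lM pM hO.
have sW := link_outer_masks lM pM hO.
have cvW : {in link_masks, forall m, size (crosscov m) = 27 /\ count id (crosscov m) <=
  5}.
  by move=> m /link_masks_table[].
have sW' : {subset O <= link_masks} by move=> m mO; apply: sW; rewrite inE mO orbT.
have cO : covers crosscov O (map negb (crosscov first_mask)).
  have := covers_rem cvW (size_nseq _ _) sW (mem_head _ _) (link_covers lM pM).
  by rewrite [rem _ _]/=.
have s0 : size (map negb (crosscov first_mask)) = 27 by [].
have sO : size O = 5.
  (* 22 = 27 - 5 cross pairs remain, which takes at least five blocks; nine blocks less the three of
     the star and [first_mask] leave at most five. *)
  have h : 22 <= 5 * size O := covers_bound cvW s0 sW' cO.
  case: lM => + _ _; rewrite (perm_size pM) size_cat /=; move: h; move: (size O) => n;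
    lia.
have /hasP[r rS pr] := cover_search_sound cvW sO s0 sW' cO.
have [e he] := all2_mem isomorphisms_ok rS.
apply: classified_perm (ex_intro _ e he).
by rewrite perm_sym; apply: perm_trans pM _; rewrite perm_cat2l perm_cons.
Qed.

Lemma link_classified M : is_link M -> classified M.
Proof.
move=> lM; have [sg psg [O pM hO]] := link_star lM; apply: (classified_relabel psg).
have lN := is_link_relabel psg lM; move: (map _ M) lN pM => {lM} N lN pN {psg sg M}.
have sW := link_outer_masks lN pN hO.
have [o oO co] : exists2 o, o \in O & count id (crosscov o) = 5.
  have [/hasP[o oO /eqP co]|] := boolP (has (fun o => count id (crosscov o) == 5) O);
    first by exists o.
  rewrite -all_predC => /allP /= n5.
  have cO := link_covers lN pN.
  have : 27 <= \sum_(o <- O) count id (crosscov o).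
    under eq_big_seq => m mO.
      have [sm _ _] := link_masks_table (sW m mO).
      rewrite -(count_nth_iota sm).
      over.
    rewrite (exchange_count (fun m k => nth false (crosscov m) k)).
    apply: (@leq_trans (\sum_(k <- iota 0 27) 1)); first by rewrite big_const_seq
      iter_addn_0 count_predT size_iota.
    rewrite !big_seq; apply: leq_sum => k; rewrite mem_iota => /andP[_ ltk].
    by rewrite -has_count; apply: cO; rewrite nth_nseq ltk.
  have : \sum_(o <- O) count id (crosscov o) <= \sum_(o <- O) 4.
    rewrite !big_seq; apply: leq_sum => m mO.
    by have [_ le5 _] := link_masks_table (sW m mO); rewrite -ltnS ltn_neqAle le5 n5.
  rewrite big_const_seq iter_addn_0 count_predT.
  case: lN => + _ _; rewrite (perm_size pN) size_cat /=; lia.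
have [_ _ /(_ co)[po ps o0]] := link_masks_table (sW o oO).
apply: (classified_relabel po); apply: (classify_star (O := map (relabel (normal_order
  o)) (rem o O))).
- exact: is_link_relabel.
- apply: perm_trans (perm_map _ pN) _; rewrite map_cat.
  apply: perm_trans (_ : perm_eq _ (star_masks ++ map (relabel (normal_order o)) O)) _;
    first by rewrite perm_cat2r.
  rewrite perm_cat2l -o0 -map_cons; apply: perm_map; exact: perm_to_rem.
- move=> m; rewrite inE => /orP[/eqP->//|/mapP[r /mem_rem /hO r0 ->]].
  by rewrite /relabel /normal_order /=.
Qed.

(** ** Blocks through a point *)

(* Entry (e, s - 4) refutes that the link of a pair xy has type e and the
   partner of x has label s; the points with labels below 4 lie on only three
   blocks of the link, so none of them is the partner. *)
Definition refutations : seq (seq tree) := [::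
[:: Branch 4 6 8 [:: Branch 5 6 8 [:: Branch 0 3 6 [::]; Branch 0 2 8 [::]; Branch 0 2 8
  [::]; Branch 0 3 6 [::]; Branch 0 5 6 [:: Branch 0 1 2 [::]; Branch 0 3 6 [::]; Branch
  1 2 6 [::]]]; Branch 1 6 8 [:: Branch 0 3 4 [::]; Branch 0 3 6 [::]; Branch 2 3 6
  [::]; Branch 0 1 8 [::]]; Branch 1 6 8 [:: Branch 0 2 4 [::]; Branch 0 2 8 [::];
  Branch 2 3 6 [::]; Branch 0 1 6 [::]]; Branch 0 6 8 [:: Branch 1 3 4 [::]; Branch 1 3
  8 [::]; Branch 2 3 6 [::]; Branch 0 1 6 [::]]; Branch 0 6 8 [:: Branch 1 2 4 [::];
  Branch 1 2 6 [::]; Branch 2 3 6 [::]; Branch 0 1 8 [::]]; Branch 5 6 8 [:: Branch 2 5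
  6 [:: Branch 0 3 6 [::]; Branch 0 3 6 [::]; Branch 0 2 3 [::]]; Branch 0 3 6 [::];
  Branch 0 2 8 [::]; Branch 0 2 8 [::]; Branch 0 3 6 [::]]];
Branch 4 6 8 [:: Branch 2 4 6 [:: Branch 1 2 6 [::]; Branch 0 3 6 [::]; Branch 0 4 9 [::
  Branch 0 2 4 [:: Branch 2 4 7 [:: Branch 0 2 8 [:: Branch 0 2 9 [::]; Branch 0 2 9
  [::]]]]]]; Branch 1 6 8 [:: Branch 0 3 6 [::]; Branch 0 1 6 [::]]; Branch 1 6 8 [::
  Branch 0 2 8 [::]; Branch 0 1 8 [::]]; Branch 0 6 8 [:: Branch 0 2 8 [::]; Branch 0 1
  8 [::]]; Branch 0 6 8 [:: Branch 0 3 6 [::]; Branch 0 1 6 [::]]; Branch 0 4 6 [::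
  Branch 0 4 8 [:: Branch 0 2 4 [:: Branch 2 4 7 [:: Branch 0 2 8 [:: Branch 0 2 9 [::];
  Branch 0 2 9 [::]]]]]; Branch 0 3 6 [::]; Branch 1 2 6 [::]]];
Branch 4 6 8 [:: Branch 2 4 8 [:: Branch 0 3 4 [::]; Branch 0 3 4 [::]; Branch 1 3 4
  [::]; Branch 0 2 8 [::]]; Branch 4 7 8 [:: Branch 0 3 4 [::]; Branch 0 1 8 [::];
  Branch 0 1 8 [::]; Branch 0 4 7 [:: Branch 0 3 4 [::]; Branch 0 1 2 [::]; Branch 1 2 4
  [::]]; Branch 0 3 4 [::]]; Branch 1 4 8 [:: Branch 0 2 4 [::]; Branch 1 3 4 [::];
  Branch 2 3 6 [::]; Branch 2 3 8 [::]]; Branch 0 4 8 [:: Branch 1 3 4 [::]; Branch 0 2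
  4 [::]; Branch 2 3 6 [::]; Branch 2 3 8 [::]]; Branch 4 7 8 [:: Branch 0 3 4 [::];
  Branch 1 4 7 [:: Branch 0 3 4 [::]; Branch 0 3 4 [::]; Branch 0 1 3 [::]]; Branch 0 1
  8 [::]; Branch 0 1 8 [::]; Branch 0 3 4 [::]]; Branch 0 4 8 [:: Branch 1 2 4 [::];
  Branch 1 2 4 [::]; Branch 1 3 4 [::]; Branch 0 2 8 [::]]];
Branch 4 6 8 [:: Branch 2 4 8 [:: Branch 0 3 4 [::]; Branch 0 2 4 [::]]; Branch 1 4 6
  [:: Branch 1 2 4 [::]; Branch 0 3 4 [::]; Branch 0 6 9 [:: Branch 0 1 6 [:: Branch 1 5
  6 [:: Branch 0 1 8 [:: Branch 0 1 9 [::]; Branch 0 1 9 [::]]]]]]; Branch 1 4 8 [::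
  Branch 1 3 8 [::]; Branch 0 1 8 [::]]; Branch 0 4 8 [:: Branch 0 2 8 [::]; Branch 0 1
  8 [::]]; Branch 0 4 6 [:: Branch 0 3 4 [::]; Branch 0 6 8 [:: Branch 0 1 6 [:: Branch
  1 5 6 [:: Branch 0 1 8 [:: Branch 0 1 9 [::]; Branch 0 1 9 [::]]]]]; Branch 1 2 4
  [::]]; Branch 0 4 8 [:: Branch 0 3 4 [::]; Branch 0 2 4 [::]]];
Branch 4 6 8 [:: Branch 2 4 6 [:: Branch 0 3 4 [::]; Branch 1 2 6 [::]; Branch 1 3 4
  [::]; Branch 1 3 4 [::]]; Branch 1 4 6 [:: Branch 0 3 4 [::]; Branch 1 2 4 [::];
  Branch 2 3 6 [::]; Branch 2 3 6 [::]]; Branch 4 6 9 [:: Branch 0 2 4 [::]; Branch 0 1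
  6 [::]; Branch 0 4 9 [:: Branch 0 2 4 [::]; Branch 1 3 4 [::]; Branch 0 1 3 [::]];
  Branch 0 1 6 [::]; Branch 0 2 4 [::]]; Branch 4 6 9 [:: Branch 0 2 4 [::]; Branch 0 1
  6 [::]; Branch 1 4 9 [:: Branch 0 2 4 [::]; Branch 0 1 2 [::]; Branch 0 2 4 [::]];
  Branch 0 1 6 [::]; Branch 0 2 4 [::]]; Branch 0 4 6 [:: Branch 1 2 4 [::]; Branch 0 3
  4 [::]; Branch 2 3 6 [::]; Branch 2 3 6 [::]]; Branch 0 4 6 [:: Branch 1 2 4 [::];
  Branch 0 3 6 [::]; Branch 1 3 4 [::]; Branch 1 3 4 [::]]];
Branch 4 6 8 [:: Branch 2 4 6 [:: Branch 1 2 4 [::]; Branch 0 2 4 [::]]; Branch 1 4 6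
  [:: Branch 1 2 6 [::]; Branch 0 1 6 [::]]; Branch 1 4 6 [:: Branch 0 2 4 [::]; Branch
  1 4 8 [:: Branch 0 2 4 [::]; Branch 0 1 2 [::]; Branch 0 2 4 [::]]; Branch 2 3 6
  [::]]; Branch 0 4 6 [:: Branch 1 3 4 [::]; Branch 2 3 6 [::]; Branch 0 4 8 [:: Branch
  0 2 4 [::]; Branch 1 3 4 [::]; Branch 0 1 3 [::]]]; Branch 0 4 6 [:: Branch 0 3 6
  [::]; Branch 0 1 6 [::]]; Branch 0 4 6 [:: Branch 0 3 4 [::]; Branch 0 2 4 [::]]]
];
[:: Branch 4 5 8 [::];
Branch 4 5 8 [::];
Branch 4 5 8 [::];
Branch 4 5 8 [::];
Branch 4 5 8 [::];
Branch 4 5 8 [::]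
];
[:: Branch 0 5 8 [:: Branch 0 3 5 [::]; Branch 0 5 9 [:: Branch 2 3 5 [::]; Branch 0 3 6
  [::]; Branch 0 2 6 [::]; Branch 0 2 8 [::]; Branch 0 1 6 [::]]; Branch 2 4 5 [::];
  Branch 0 1 5 [::]; Branch 2 4 5 [::]; Branch 1 5 6 [::]; Branch 1 4 6 [::]; Branch 0 2
  5 [::]; Branch 0 1 6 [::]];
Branch 0 4 8 [:: Branch 0 4 9 [:: Branch 2 3 4 [::]; Branch 0 2 6 [::]; Branch 0 3 6
  [::]; Branch 0 3 8 [::]; Branch 0 1 6 [::]]; Branch 0 2 4 [::]; Branch 2 4 5 [::];
  Branch 0 1 4 [::]; Branch 3 4 5 [::]; Branch 1 4 6 [::]; Branch 1 4 6 [::]; Branch 0 3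
  4 [::]; Branch 0 1 6 [::]];
Branch 0 4 8 [:: Branch 0 4 9 [:: Branch 0 3 5 [::]; Branch 0 1 5 [::]; Branch 1 3 4
  [::]; Branch 0 3 8 [::]; Branch 0 1 5 [::]]; Branch 0 2 4 [::]; Branch 2 4 5 [::];
  Branch 3 4 6 [::]; Branch 0 1 4 [::]; Branch 1 4 6 [::]; Branch 1 4 6 [::]; Branch 0 2
  5 [::]; Branch 0 3 4 [::]];
Branch 1 4 8 [:: Branch 1 4 9 [:: Branch 0 3 5 [::]; Branch 0 1 5 [::]; Branch 0 3 4
  [::]; Branch 0 4 7 [::]; Branch 0 1 5 [::]]; Branch 0 2 4 [::]; Branch 2 4 5 [::];
  Branch 3 4 7 [::]; Branch 0 1 4 [::]; Branch 0 4 7 [::]; Branch 1 2 5 [::]; Branch 0 4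
  7 [::]; Branch 0 4 7 [::]]
];
[:: Branch 5 6 8 [::];
Branch 4 7 9 [::];
Branch 4 5 8 [::];
Branch 4 5 8 [::];
Branch 4 7 9 [::];
Branch 5 6 8 [::]
]].

(** The last label, 10, is y: the blocks still to be found contain x but not y. *)
Definition outer_masks := [seq rcons m false | m <- words 10 5].

(** The fuel 11 = 20 - 9 is the number of missing blocks on x. *)
Definition refuted e s :=
  refute s 11 outer_masks [seq rcons m true | m <- map (mask_of 10) (canon e)]
    (nth (Branch 0 0 0 [::]) (nth [::] refutations e) (s - 4)).

Lemma refuted_all : all (fun e => all (refuted e) (iota 4 (if e == 2 then 4 else 6)))
  (iota 0 4).
Proof. exact_no_check (erefl true). Qed.

Lemma count_enum (T : finType) (P : pred T) : count P (enum T) = #|P|.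
Proof. by rewrite -sum1_card -sum1_count big_enum_cond; apply: eq_bigl. Qed.

(** * Counting the blocks on points, pairs and triples *)

Section Design.

Variables (T : finType) (F : seq {set T}).
Hypothesis card_points : #|T| = 12.
Hypothesis card_block : {in F, forall b : {set T}, #|b| = 6}.

Definition inside (s : seq T) (b : {set T}) := all [in b] s.

Hypothesis coverF : forall s, size s = 4 -> uniq s -> has (inside s) F.

Definition cov s := count (inside s) F.

Lemma inside_mem s s' b : s =i s' -> inside s b = inside s' b.
Proof. by move=> e; apply: eq_all_r. Qed.

Lemma cov_mem s s' : s =i s' -> cov s = cov s'.
Proof. by move=> e; apply: eq_count => b; apply: inside_mem. Qed.

Lemma sum_cov s : \sum_z cov (z :: s) = 6 * cov s.
Proof.
rewrite (eq_bigr (fun z => \sum_(b <- F) (inside (z :: s) b : nat))); last first.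
  by move=> z _; rewrite /cov -sum1_count big_mkcond.
rewrite exchange_big /cov -sum1_count big_distrr [RHS]big_mkcond; apply: eq_big_seq => b
  bF.
case: ifP => sb.
  transitivity #|b|; last exact: card_block.
  by rewrite -sum1_card [RHS]big_mkcond; apply: eq_bigr => z _; rewrite -[inside _
    _]/((z \in b) && inside s b) sb andbT.
by rewrite big1 // => z _; rewrite -[inside _ _]/((z \in b) && inside s b) sb andbF.
Qed.

Lemma sum_cov_out s : uniq s -> \sum_(z | z \notin s) cov (z :: s) + size s * cov s = 6
  * cov s.
Proof.
move=> us; rewrite -sum_cov [RHS](bigID [in s]) /= addnC; congr addn.
rewrite (eq_bigr (fun=> cov s)) ?sum_nat_const -?(card_uniqP us) // => z zs.
by apply: cov_mem => w; rewrite inE; case: eqVneq => // ->.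
Qed.

Lemma card_out (s : seq T) : uniq s -> #|[pred z | z \notin s]| = 12 - size s.
Proof.
move=> us; have : size s + #|[pred z | z \notin s]| = 12.
  by rewrite -(card_uniqP us) -[RHS]card_points; apply: cardC.
by move=> h; rewrite -(addKn (size s) #|_|) h.
Qed.

(* The step of the Schönheim bound. *)
Lemma cov_step s n : uniq s -> size s <= 5 -> (forall z, z \notin s -> n <= cov (z ::
  s)) ->
  (12 - size s) * n <= (6 - size s) * cov s.
Proof.
move=> us ss h; rewrite !mulnBl; have := sum_cov_out us.
have : \sum_(z | z \notin s) n <= \sum_(z | z \notin s) cov (z :: s) by apply: leq_sum.
rewrite sum_nat_const card_out // !mulnBl.
by move: (\sum_(_ | _) _) => S h1 <-; rewrite addnK.
Qed.

Definition pmask (ps : seq T) (b : {set T}) := [seq p \in b | p <- ps].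

Lemma pmask_incl x ps s b : all (fun i => i < size ps) s ->
  incl s (pmask ps b) = inside [seq nth x ps i | i <- s] b.
Proof.
move=> /allP ls; rewrite /incl /inside all_map; apply: eq_in_all => i /ls lt /=.
by rewrite (nth_map x).
Qed.

Lemma perm_points (s : seq T) : uniq s -> size s = 12 -> perm_eq s (enum T).
Proof.
move=> us ss; have sub : {subset s <= enum T} by move=> z; rewrite mem_enum.
have sz : size (enum T) <= size s by rewrite -cardE card_points ss.
by apply: uniq_perm; rewrite ?enum_uniq //; apply: (uniq_min_size us sub sz).2.
Qed.

Lemma pmask_count s ps b : uniq (s ++ ps) -> size (s ++ ps) = 12 -> b \in F -> inside s
  b ->
  size s + count id (pmask ps b) = 6.
Proof.
move=> us ss bF sb; rewrite /pmask count_map.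
have := permP (perm_points us ss) [in b]; rewrite count_cat.
have -> : count [in b] s = size s by apply/eqP; rewrite -all_count.
by move=> ->; rewrite -[RHS](card_block bF) count_enum.
Qed.

(** An isomorphism from the link of x and y to a canonical covering, given by listing the other ten
    points in the order of their labels. *)
Definition labelled x y ps e :=
  [/\ uniq ([:: x; y] ++ ps), size ps = 10, e < 4 &
      perm_eq [seq pmask ps b | b <- F & inside [:: x; y] b] (map (mask_of 10) (canon
        e))].

Lemma link_labelled x y : x != y -> cov [:: x; y] <= 9 -> exists ps e, labelled x y ps
  e.
Proof.
move=> ne c9; pose qs := [seq z <- enum T | z \notin [:: x; y]].
have uxy : uniq [:: x; y] by rewrite /= inE ne.
have uq : uniq ([:: x; y] ++ qs).
  rewrite cat_uniq uxy filter_uniq ?enum_uniq // andbT.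
  by apply/hasPn => z; rewrite mem_filter => /andP[].
have sq : size qs = 10 by rewrite size_filter count_enum card_out.
pose M := [seq pmask qs b | b <- F & inside [:: x; y] b].
have lM : is_link M.
  split; first by rewrite size_map size_filter.
    move=> m /mapP[b]; rewrite mem_filter => /andP[xyb bF] ->; split; first by rewrite
      size_map.
    by have := pmask_count uq _ bF xyb; rewrite size_cat sq => /(_ (erefl _))
      /succn_inj/succn_inj.
  move=> i j lti ltj nij; set p := nth x qs i; set q := nth x qs j.
  have pin : p \in qs by rewrite mem_nth // sq.
  have qin : q \in qs by rewrite mem_nth // sq.
  have npq : p != q by rewrite nth_uniq ?sq //; move: uq; rewrite cat_uniq => /and3P[].
  have upq : uniq ([:: x; y] ++ [:: p; q]).
    move: pin qin; rewrite !mem_filter => /andP[np _] /andP[nq _].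
    by rewrite cat_uniq uxy /= orbF negb_or np nq inE npq.
  have /hasP[b bF hb] := coverF (erefl : size ([:: x; y] ++ [:: p; q]) = 4) upq.
  move: hb; rewrite /inside all_cat => /andP[xyb pqb].
  apply/hasP; exists (pmask qs b).
    by apply/mapP; exists b => //; rewrite mem_filter bF andbT.
  by rewrite (pmask_incl x) //= sq lti ltj.
have [[e sg] /and3P[]] := link_classified lM; rewrite [_.1]/= [_.2]/= => lte psg pM.
have ssg : size sg = 10 by rewrite (perm_size psg) size_iota.
have pqs : perm_eq [seq nth x qs i | i <- sg] qs.
  apply: perm_trans (perm_map _ psg) _; rewrite -sq map_nth_iota0 // take_size; exact:
    perm_refl.
exists [seq nth x qs i | i <- sg], e; split=> //.
- by rewrite (perm_uniq (_ : perm_eq _ ([:: x; y] ++ qs))) // perm_cat2l.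
- by rewrite size_map.
apply: perm_trans pM; rewrite -map_comp; apply/permP => P; congr count; apply/eq_map =>
  b /=.
rewrite /pmask /relabel -map_comp; apply/eq_in_map => i /=.
by rewrite (perm_mem psg) mem_iota => /andP[_ lti]; rewrite (nth_map x) // sq.
Qed.

Lemma labelled_cov x y ps e s : labelled x y ps e -> all (fun i => i < 10) s ->
  cov ([:: x; y] ++ [seq nth x ps i | i <- s]) = count (incl s) (map (mask_of 10) (canon
    e)).
Proof.
move=> [_ sp _ /permP <-] ls; rewrite count_map count_filter; apply: eq_count => b /=.
by rewrite (pmask_incl x) ?sp // /inside /=; case: (x \in b); case: (y \in b); rewrite
  ?andbT ?andbF.
Qed.

(** If at most nine blocks contain the pair, the classification applies, and each of the four
    canonical coverings has exactly nine. *)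
Lemma cov2_ge9 x y : x != y -> 9 <= cov [:: x; y].
Proof.
move=> ne; case: (leqP (cov [:: x; y]) 9) => [le9|/ltnW//].
have [ps [e lab]] := link_labelled ne le9.
have := labelled_cov (s := [::]) lab (erefl _); rewrite cats0 => ->; case: lab => _ _
  lte _.
by case: e lte => [|[|[|[]]]].
Qed.

(** 11 * 9 = 99 pairs on [x] at five per block require 20 blocks. *)
Lemma cov1_ge20 x : 20 <= cov [:: x].
Proof.
have := @cov_step [:: x] 9 (erefl _) (erefl _).
have h z : z \notin [:: x] -> 9 <= cov [:: z; x] by rewrite inE; apply: cov2_ge9.
by move=> /(_ h) /=; lia.
Qed.

Hypothesis size_le40 : size F <= 40.

(** Equality is forced because 12 * 20 = 6 * 40 leaves no slack. *)
Lemma cov1 x : cov [:: x] = 20.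
Proof.
have := sum_cov_out (erefl : uniq [::]); rewrite mul0n addn0 /cov count_predT -/cov.
rewrite (bigD1 x) //=.
have : \sum_(z | z != x) 20 <= \sum_(z | z != x) cov [:: z] by apply: leq_sum => z _;
  apply: cov1_ge20.
rewrite sum_nat_const; have -> : #|[pred z | z != x]| = 11.
  by have := cardC1 x; rewrite card_points.
rewrite -!/(cov [:: _]); have := cov1_ge20 x.
move: (\sum_(_ | _) _) (cov _) (size F) size_le40 => S c n; lia.
Qed.

(** The twenty blocks on [x] contribute 5 * 20 = 11 * 9 + 1 pairs, so the excess over 9 is a single
    unit, and the point that receives it is the partner. *)
Lemma partner_exists x : exists x', [&& x' != x, cov [:: x; x'] == 10 &
  [forall y, (y \notin [:: x; x']) ==> (cov [:: x; y] == 9)]].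
Proof.
have covC y : cov [:: y; x] = cov [:: x; y] by apply: cov_mem => w; rewrite !inE orbC.
have := sum_cov_out (erefl : uniq [:: x]); rewrite cov1.
rewrite (eq_bigr (fun z => 9 + (cov [:: x; z] - 9))); last first.
  by move=> z; rewrite inE => zx; rewrite covC subnKC // cov2_ge9 // eq_sym.
rewrite big_split /= sum_nat_const card_out // => h.
have /eqP/sum_nat_eq1[x' []] : \sum_(z | z \notin [:: x]) (cov [:: x; z] - 9) = 1.
  by move: h; rewrite [size _]/=; move: (\sum_(_ | _) _) => S; lia.
rewrite inE => nx hx hy; exists x'; rewrite nx /=; apply/andP; split.
  by apply/eqP; move: hx; move: (cov _) => c; lia.
apply/forallP => y; apply/implyP; rewrite !inE negb_or => /andP[yx yx'].
have := hy y yx'; rewrite inE yx => /(_ isT).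
have := @cov2_ge9 x y; rewrite eq_sym yx => /(_ isT); move: (cov _) => c ? ?; apply/eqP;
  lia.
Qed.

Lemma canon_degree e i : e < 4 -> i < 10 ->
  let c := count (incl [:: i]) (map (mask_of 10) (canon e)) in c <= 4 /\ (c = 4 -> 4 <=
    i).
Proof.
have : all (fun e => all (fun i => let c := count (incl [:: i]) (map (mask_of 10) (canon
  e)) in
  (c <= 4) && ((c == 4) ==> (4 <= i))) (iota 0 10)) (iota 0 4) by [].
move=> /allP h lte lti; have le : e \in iota 0 4 by rewrite mem_iota.
have li : i \in iota 0 10 by rewrite mem_iota.
have /andP[c4 /implyP i4] := allP (h e le) i li.
by split=> // /eqP.
Qed.

Lemma labelled_mem x y ps e z : labelled x y ps e -> z \notin [:: x; y] -> z \in ps.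
Proof.
move=> [u s _ _] nz; have := perm_mem (perm_points u _) z; rewrite /= s => /(_ (erefl
  _)).
by rewrite mem_enum !inE orbA; move: nz; rewrite !inE => /negPf ->.
Qed.

Lemma link_le4 x y z : x != y -> cov [:: x; y] <= 9 -> z \notin [:: x; y] -> cov [:: x;
  y; z] <= 4.
Proof.
move=> ne c9 nz; have [ps [e lab]] := link_labelled ne c9.
have zps := labelled_mem lab nz; have [_ sps lte _] := lab.
have lt : index z ps < 10 by rewrite -sps index_mem.
have := labelled_cov (s := [:: index z ps]) lab; rewrite /= lt nth_index // => -> //.
by have [] := canon_degree lte lt.
Qed.

(** * The partner map and the links that it leaves possible *)

Section Partner.

Variable f : T -> T.
Hypothesis fP : forall x, [&& f x != x, cov [:: x; f x] == 10 &
  [forall y, (y \notin [:: x; f x]) ==> (cov [:: x; y] == 9)]].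

Lemma partner_neq x : f x != x. Proof. by case/and3P: (fP x). Qed.

Lemma cov_partner x : cov [:: x; f x] = 10. Proof. by case/and3P: (fP x) => _ /eqP. Qed.

Lemma cov_nonpartner x y : y \notin [:: x; f x] -> cov [:: x; y] = 9.
Proof. by case/and3P: (fP x) => _ _ /forallP/(_ y)/implyP h /h/eqP. Qed.

Lemma partnerK x : f (f x) = x.
Proof.
apply/eqP/negPn/negP => ne; have := @cov_nonpartner (f x) x.
rewrite !inE negb_or eq_sym partner_neq eq_sym ne => /(_ isT).
by rewrite (@cov_mem _ [:: x; f x]) ?cov_partner // => z; rewrite !inE orbC.
Qed.

(** At most one of [u] and [v] is the partner of [x]. With the other one [x] lies on nine blocks, so
    that link is canonical and its degrees are at most 4. *)
Lemma cov3_le4 x u v : uniq [:: x; u; v] -> cov [:: x; u; v] <= 4.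
Proof.
move=> un; wlog nu : u v un / u != f x => [h|].
  have [e|] := eqVneq u (f x); last exact: (h u v un).
  rewrite (@cov_mem _ [:: x; v; u]); last by move=> z; rewrite !inE; case: (z == x);
    case: (z == u); case: (z == v).
  move: un; rewrite /= !inE negb_or andbT => /andP[/andP[xu xv] uv].
  by apply: h; [rewrite /= !inE negb_or xu xv eq_sym uv | rewrite -e eq_sym].
move: un; rewrite /= !inE negb_or andbT => /andP[/andP[xu xv] uv].
apply: link_le4 => //; first by rewrite cov_nonpartner // !inE negb_or nu eq_sym xu.
by rewrite !inE negb_or ![v == _]eq_sym xv uv.
Qed.

(** The ten blocks on [x] and [f x] have four further points each; these 40 incidences fall on ten
    points, each with at most 4. *)
Lemma cov_special x z : z \notin [:: x; f x] -> cov [:: x; f x; z] = 4.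
Proof.
move=> nz; have u : uniq [:: x; f x] by rewrite /= inE eq_sym partner_neq.
have covr y : cov [:: x; f x; y] = cov [:: y; x; f x].
  by apply: cov_mem => w; rewrite !inE; case: (w == x); case: (w == f x); case: (w ==
    y).
have le4 y : y \notin [:: x; f x] -> cov [:: y; x; f x] <= 4.
  move=> ny; rewrite -covr cov3_le4 //= !inE negb_or eq_sym partner_neq /=.
  by move: ny; rewrite !inE negb_or ![y == _]eq_sym => /andP[-> ->].
have := sum_cov_out u; rewrite cov_partner (bigD1 z) //=.
have : \sum_(y | (y \notin [:: x; f x]) && (y != z)) cov [:: y; x; f x] <=
       \sum_(y | (y \notin [:: x; f x]) && (y != z)) 4.
  by apply: leq_sum => y /andP[/le4].
have c9 : #|[pred y | (y \notin [:: x; f x]) && (y != z)]| = 9.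
  have := card_out u; rewrite (cardD1 z) inE nz [size _]/= => h.
  apply: (@addnI 1); rewrite -[RHS]h; congr addn.
  by apply: eq_card => y; rewrite !inE andbC.
rewrite sum_nat_const c9 covr; have := le4 _ nz.
by move: (cov _) (\sum_(_ | _) _) => c S; lia.
Qed.

Lemma special_class x y ps e : labelled x y ps e -> y \notin [:: x; f x] ->
  e = 2 /\ (f x = nth x ps 8 \/ f x = nth x ps 9).
Proof.
move=> lab ny; have [u sps lte pm] := lab.
have nfx : f x \notin [:: x; y].
  by move: ny; rewrite !inE !negb_or partner_neq [f x == y]eq_sym => /andP[].
have fps := labelled_mem lab nfx.
pose s := index (f x) ps.
have lts : s < 10 by rewrite -sps index_mem.
have nths : nth x ps s = f x by rewrite nth_index.
(* By [cov_special], [f x] has degree 4 in the link of [x] and [y]. *)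
have s4 : 4 <= s.
  have := labelled_cov (s := [:: s]) lab; rewrite /= lts nths => /(_ isT).
  rewrite (@cov_mem _ [:: x; f x; y]) ?cov_special // => [h|w]; last first; first by
    rewrite !inE; case: (w == x); case: (w == f x); case: (w == y).
  by have [_] := canon_degree lte lts; rewrite /= -h; apply.
(* Appending [y] gives it label 10, as in [outer_masks]. *)
pose qs := rcons ps y.
have uq : uniq (x :: qs).
  rewrite (perm_uniq (_ : perm_eq _ ([:: x; y] ++ ps))) //.
  by rewrite perm_cons perm_rcons.
have sq : size qs = 11 by rewrite size_rcons sps.
have usq : uniq qs by case/andP: uq.
pose Fx : seq {set T} := [seq b : {set T} <- F | x \in b].
pose Fy : seq {set T} := [seq b : {set T} <- Fx | y \in b].
pose Fn : seq {set T} := [seq b : {set T} <- Fx | y \notin b].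
pose M := map (pmask qs) Fx.
have covM t : all (fun i => i < 11) t -> count (incl t) M = cov (x :: [seq nth x qs i |
  i <- t]).
  move=> lt; rewrite count_map count_filter; apply: eq_count => b /=.
  by rewrite (pmask_incl x) ?sq // andbC.
have nthx i : i < 11 -> nth x qs i != x.
  move=> lti; apply/eqP => h; move: uq => /= /andP[/negP[]].
  by rewrite -[X in X \in _]h mem_nth // sq.
have nthu i j : i < 11 -> j < 11 -> (nth x qs i == nth x qs j) = (i == j).
  by move=> *; rewrite nth_uniq ?sq.
have nthf i : i < 11 -> (nth x qs i == f x) = (i == s).
  move=> lti; have <- : nth x qs s = f x by rewrite nth_rcons sps lts.
  by rewrite nthu // ltnW.
have pM : perm_eq M ([seq rcons m true | m <- map (mask_of 10) (canon e)] ++ map (pmask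
  qs) Fn).
  have pF : perm_eq Fx (Fy ++ Fn) by rewrite perm_sym; apply/permPl/perm_filterC.
  apply: perm_trans (perm_map _ pF) _; rewrite map_cat perm_cat2r.
  have -> : map (pmask qs) Fy = [seq rcons m true | m <- [seq pmask ps b | b <- F &
    inside [:: x; y] b]].
    rewrite -map_comp /Fy /Fx -filter_predI (eq_filter (a2 := inside [:: x; y])); last
      first.
      by move=> b; rewrite /= andbT andbC.
    apply/eq_in_map => b; rewrite mem_filter => /andP[/and3P[_ yb _] _] /=.
    by rewrite /pmask map_rcons yb.
  exact: perm_map.
have countx t : all (fun i => i < 11) t -> uniq t -> uniq (x :: [seq nth x qs i | i <-
  t]).
  move=> /allP lt ut; rewrite cons_uniq; apply/andP; split.
    by apply/mapP => -[i /lt lti xi]; move: (nthx i lti); rewrite -xi eqxx.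
  by rewrite map_inj_in_uniq // => i j /lt lti /lt ltj /eqP; rewrite nthu // => /eqP.
(* The blocks on [x] exist, so no tree can refute them; each entry of the table therefore excludes
   its position of [f x]. *)
have ref t : ~~ refute s 11 outer_masks [seq rcons m true | m <- map (mask_of 10) (canon
  e)] t.
  apply: (@refute_sound s M _ _ _ _ _ _ _ _ _ _ pM).
  - move=> m /mapP[b]; rewrite mem_filter => /andP[xb bF] ->; rewrite size_map; split=>
    //.
    have := pmask_count (s := [:: x]) uq _ bF; rewrite /= sq xb => /(_ erefl isT).
    exact: succn_inj.
  - move=> i j k lti ltj ltk ut; rewrite has_count covM /= ?lti ?ltj ?ltk // -has_count.
    by apply: coverF => //; apply: (countx [:: i; j; k]) => //=; rewrite lti ltj ltk.
  - move=> i j lti ltj ne; rewrite /through covM /= ?lti ?ltj //.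
    by apply: cov3_le4; apply: (countx [:: i; j]); rewrite /= ?lti ?ltj // inE ne.
  - move=> i lti; rewrite (eq_count (a2 := incl [:: i])); last by move=> m; rewrite
    /incl /= andbT.
    rewrite covM /= ?lti // -nthf //; case: eqVneq => [->|nf]; first by rewrite
      cov_partner.
    by rewrite cov_nonpartner // !inE negb_or nf nthx.
  - move=> i lti ne; rewrite /through covM /= ?lti ?(leqW lts) //.
    rewrite [nth x qs s]nth_rcons sps lts nths cov_special // !inE negb_or nthx // nthf
      //.
  - move=> m /mapP[b]; rewrite !mem_filter => /and3P[yb xb bF] ->.
    have c5 : count id (pmask ps b) = 5.
      have := pmask_count (s := [:: x]) uq _ bF; rewrite /= sq xb => /(_ erefl isT)
        /succn_inj.
      by rewrite /pmask map_rcons -cats1 count_cat /= (negPf yb) [_ + _]addn0.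
    have s10 : size (pmask ps b) = 10 by rewrite size_map.
    rewrite {1}/pmask map_rcons (negPf yb); apply: (map_f (rcons^~ false)).
    by have := words_mem (pmask ps b); rewrite c5 s10.
have le : e \in iota 0 4 by rewrite mem_iota.
have h : s \notin iota 4 (if e == 2 then 4 else 6).
  by apply/negP => hs; have := allP (allP refuted_all e le) s hs; rewrite /refuted
    (negPf (ref _)).
move: h; rewrite mem_iota s4; have [-> /= h|_] := eqVneq e 2; last by rewrite lts.
split=> //; have /orP[/eqP s8|/eqP s9] : (s == 8) || (s == 9).
- by move: h lts; move: (s) => n; clear; lia.
- by left; rewrite -nths s8.
by right; rewrite -nths s9.
Qed.

(** One labelling serves both orders of the pair, so [f x] and [f y] both carry label 8 or 9, and no
    block of the third covering separates these labels. *)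
Lemma partner_block x y (b : {set T}) : y \notin [:: x; f x] -> b \in F ->
  x \in b -> f x \in b -> y \in b -> f y \in b.
Proof.
move=> ny bF xb fxb yb.
have ne : x != y by move: ny; rewrite !inE negb_or eq_sym => /andP[].
have nx : x \notin [:: y; f y].
  rewrite !inE negb_or ne /=; apply: contra ny => /eqP ->.
  by rewrite partnerK !inE eqxx orbT.
have [ps [e lab]] : exists ps e, labelled x y ps e by apply: link_labelled; rewrite
  ?cov_nonpartner.
have lab' : labelled y x ps e.
  case: lab => u sps lte pm; split=> //.
    by rewrite (perm_uniq (_ : perm_eq _ ([:: x; y] ++ ps))) // (perm_cat2r ps [:: y;
      x]) (perm_catC [:: y]).
  by rewrite (eq_filter (a2 := inside [:: x; y])) // => c; rewrite /inside /= !andbT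
    andbC.
have [e2 fx] := special_class lab ny; have [_ fy] := special_class lab' nx.
case: lab => _ sps _ pm; rewrite e2 in pm.
have : pmask ps b \in map (mask_of 10) (canon 2).
  rewrite -(perm_mem pm); apply: (map_f (pmask ps)).
  by rewrite mem_filter bF /inside /= xb yb.
have /allP h : all (fun m => nth false m 8 == nth false m 9) (map (mask_of 10) (canon
  2)) by [].
move/h; rewrite !(nth_map x) ?sps // => /eqP p89.
rewrite !(set_nth_default x) ?sps // in fy.
by case: fx fxb => ->; case: fy => ->; rewrite ?p89 // -p89.
Qed.

(** ** Transversal blocks *)

Definition closed (b : {set T}) := [exists x, (x \in b) && (f x \in b)].

Lemma closedP b y : b \in F -> closed b -> y \in b -> f y \in b.
Proof.
move=> bF /existsP[x /andP[xb fxb]] yb.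
have [|] := boolP (y \in [:: x; f x]); last by move=> ny; apply: (@partner_block x).
by rewrite !inE => /orP[] /eqP ->; rewrite ?partnerK.
Qed.

(** [b] and its image under [f] are disjoint sets of six points, so together they are all twelve. *)
Lemma transversal b z : b \in F -> ~~ closed b -> (f z \in b) = (z \notin b).
Proof.
move=> bF nb; have fI : injective f := can_inj partnerK.
have d : [disjoint b & f @: b].
  rewrite disjoint_sym; apply/pred0P => y /=; apply/negP => /andP[/imsetP[w wb ->] fwb].
  by case/negP: nb; apply/existsP; exists w; rewrite wb.
have cU : #|b :|: f @: b| = #|T|.
  by rewrite cardsU disjoint_setI0 // cards0 subn0 card_imset // card_block //
    card_points.
have /eqP eU : b :|: f @: b == [set: T] by rewrite eqEcard subsetT cardsT cU /=.
have [zb|nz] := boolP (z \in b).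
  by apply: contraNF nb => fzb; apply/existsP; exists z; rewrite zb.
have : z \in b :|: f @: b by rewrite eU inE.
by rewrite inE (negPf nz) => /imsetP[w wb ->]; rewrite partnerK.
Qed.

Definition tcov s := count (fun b => ~~ closed b && inside s b) F.

Lemma tcov_mem s s' : s =i s' -> tcov s = tcov s'.
Proof. by move=> e; apply: eq_count => b; rewrite (inside_mem b e). Qed.

Lemma count_split (S : Type) (P Q : pred S) r :
  count P r = count (fun x => Q x && P x) r + count (fun x => ~~ Q x && P x) r.
Proof. by elim: r => //= x r ->; case: (Q x); case: (P x) => /=; lia. Qed.

Lemma tcov_split s z : tcov s = tcov (z :: s) + tcov (f z :: s).
Proof.
rewrite /tcov (count_split _ (fun b : {set T} => z \in b)); congr addn.
  by apply: eq_count => b; rewrite /inside /= andbCA.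
apply: eq_in_count => b bF; rewrite /inside /= andbCA; case nb: (closed b) => //=.
by rewrite transversal // nb.
Qed.

(* The remaining 4 of the 9 blocks through x and y are closed: they are the
   blocks through x, f x and y. *)
Lemma tcov2 x y : y \notin [:: x; f x] -> tcov [:: x; y] = 5.
Proof.
move=> ny; have := cov_nonpartner ny; rewrite /cov (count_split _ (fun b => ~~ closed
  b)) -/(tcov _).
rewrite (@eq_in_count _ _ (inside [:: x; f x; y])); first by rewrite -/(cov _)
  cov_special //; lia.
move=> b bF /=; rewrite negbK; apply/andP/and4P => [[cb /and3P[xb yb _]]|[xb fxb yb _]].
  by split=> //; apply: closedP.
by split; [apply/existsP; exists x; rewrite xb | rewrite /inside /= xb yb].
Qed.

Lemma apartE x y : y \notin [:: x; f x] ->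
  [/\ (x == y) = false, (x == f y) = false, (f x == y) = false & (f x == f y) = false].
Proof.
rewrite !inE negb_or (inj_eq (can_inj partnerK)) ![_ == y]eq_sym -[y == f x](inj_eq
  (can_inj partnerK)) partnerK.
by rewrite [y == x]eq_sym [f y == x]eq_sym => /andP[/negPf-> /negPf e]; split=> //;
  rewrite -e -[RHS](inj_eq (can_inj partnerK)) partnerK.
Qed.

Definition flip (i : bool) x := if i then f x else x.

Lemma apart_flip i j x y : y \notin [:: x; f x] -> flip j y \notin [:: flip i x; f (flip
  i x)].
Proof.
move/apartE => [h1 h2 h3 h4].
by case: i; case: j; rewrite !inE ?partnerK /= ![_ == x]eq_sym ![_ == f x]eq_sym ?h1 ?h2
  ?h3 ?h4.
Qed.

(** A closed block on four points from different pairs would contain eight points. *)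
Lemma tcov4 a b c d : b \notin [:: a; f a] -> c \notin [:: a; f a] -> c \notin [:: b; f
  b] ->
  d \notin [:: a; f a] -> d \notin [:: b; f b] -> d \notin [:: c; f c] -> 0 < tcov [::
    a; b; c; d].
Proof.
move=> /apartE[ab1 ab2 ab3 ab4] /apartE[ac1 ac2 ac3 ac4] /apartE[bc1 bc2 bc3 bc4].
move=> /apartE[ad1 ad2 ad3 ad4] /apartE[bd1 bd2 bd3 bd4] /apartE[cd1 cd2 cd3 cd4].
have ff x : (x == f x) = false by rewrite eq_sym; apply: negbTE (partner_neq x).
have u : uniq [:: a; f a; b; f b; c; f c; d; f d].
  by rewrite /= !inE !ff ab1 ab2 ab3 ab4 ac1 ac2 ac3 ac4 bc1 bc2 bc3 bc4 ad1 ad2 ad3 ad4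
    bd1 bd2 bd3 bd4 cd1 cd2 cd3 cd4.
have u4 : uniq [:: a; b; c; d] by rewrite /= !inE ab1 ac1 ad1 bc1 bd1 cd1.
have /hasP[B BF hB] := coverF (erefl : size [:: a; b; c; d] = 4) u4.
rewrite -has_count; apply/hasP; exists B; rewrite // hB andbT; apply/negP => clB.
case/and5P: hB => aB bB cB dB _.
have sub : {subset [:: a; f a; b; f b; c; f c; d; f d] <= enum B}.
  apply/allP; rewrite /= !mem_enum aB bB cB dB /=.
  by rewrite !(closedP BF clB).
by have := uniq_leq_size u sub; rewrite -cardE card_block.
Qed.

Lemma no_forty : False.
Proof.
have pick (s : seq T) : size s < 12 -> exists z, z \notin s.
  move=> ss; have [/existsP //|h] := boolP [exists z, z \notin s].
  have : #|T| <= size s.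
    apply: leq_trans (card_size s); apply: subset_leq_card; apply/subsetP => z _.
    by apply: contraNT h => nz; apply/existsP; exists z.
  by rewrite card_points leqNgt ss.
have /card_gt0P[a _] : 0 < #|T| by rewrite card_points.
have [b nb] := pick [:: a; f a] isT.
have [c nc] := pick [:: a; f a; b; f b] isT.
have [d nd] := pick [:: a; f a; b; f b; c; f c] isT.
have ca : c \notin [:: a; f a] by apply: contra nc; rewrite !inE => /orP[] ->; rewrite
  ?orbT.
have cb : c \notin [:: b; f b] by apply: contra nc; rewrite !inE => /orP[] ->; rewrite
  ?orbT.
have da : d \notin [:: a; f a] by apply: contra nd; rewrite !inE => /orP[] ->; rewrite
  ?orbT.
have db : d \notin [:: b; f b] by apply: contra nd; rewrite !inE => /orP[] ->; rewrite
  ?orbT.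
have dc : d \notin [:: c; f c] by apply: contra nd; rewrite !inE => /orP[] ->; rewrite
  ?orbT.
pose V i j k l := tcov [:: flip i a; flip j b; flip k c; flip l d].
(* V counts the transversal blocks by their trace on four partner pairs; its
   values on the 4-cube are positive and add up to 5 on each 2-face. *)
have V_gt0 i j k l : 0 < V i j k l by apply: tcov4; apply: apart_flip.
have quad s z w : tcov s = tcov (w :: z :: s) + tcov (f w :: z :: s) + tcov (w :: f z ::
  s) + tcov (f w :: f z :: s).
  by rewrite (tcov_split s z) (tcov_split (z :: s) w) (tcov_split (f z :: s) w) !addnA.
(* [quad] puts the two new points in front; these permutations restore the order a, b, c, d. *)
have pab x y z w : tcov [:: w; z; x; y] = tcov [:: x; y; z; w].
  by apply: tcov_mem => t; rewrite !inE; case: (t == x); case: (t == y); case: (t == z);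
    case: (t == w).
have pac x y z w : tcov [:: w; y; x; z] = tcov [:: x; y; z; w].
  by apply: tcov_mem => t; rewrite !inE; case: (t == x); case: (t == y); case: (t == z);
    case: (t == w).
have pad x y z w : tcov [:: z; y; x; w] = tcov [:: x; y; z; w].
  by apply: tcov_mem => t; rewrite !inE; case: (t == x); case: (t == y); case: (t == z);
    case: (t == w).
have pbc x y z w : tcov [:: w; x; y; z] = tcov [:: x; y; z; w].
  by apply: tcov_mem => t; rewrite !inE; case: (t == x); case: (t == y); case: (t == z);
    case: (t == w).
have pbd x y z w : tcov [:: z; x; y; w] = tcov [:: x; y; z; w].
  by apply: tcov_mem => t; rewrite !inE; case: (t == x); case: (t == y); case: (t == z);
    case: (t == w).
have pcd x y z w : tcov [:: y; x; z; w] = tcov [:: x; y; z; w].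
  by apply: tcov_mem => t; rewrite !inE; case: (t == x); case: (t == y); case: (t == z);
    case: (t == w).
have Hab i j : V i j false false + V i j false true + V i j true false + V i j true true
  = 5.
  by rewrite -(tcov2 (apart_flip i j nb)) (quad _ c d); congr (_ + _ + _ + _); apply:
    esym; exact: pab.
have Hac i j : V i false j false + V i false j true + V i true j false + V i true j true
  = 5.
  by rewrite -(tcov2 (apart_flip i j ca)) (quad _ b d); congr (_ + _ + _ + _); apply:
    esym; exact: pac.
have Had i j : V i false false j + V i false true j + V i true false j + V i true true j
  = 5.
  by rewrite -(tcov2 (apart_flip i j da)) (quad _ b c); congr (_ + _ + _ + _); apply:
    esym; exact: pad.
have Hbc i j : V false i j false + V false i j true + V true i j false + V true i j true
  = 5.
  by rewrite -(tcov2 (apart_flip i j cb)) (quad _ a d); congr (_ + _ + _ + _); apply: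
    esym; exact: pbc.
have Hbd i j : V false i false j + V false i true j + V true i false j + V true i true j
  = 5.
  by rewrite -(tcov2 (apart_flip i j db)) (quad _ a c); congr (_ + _ + _ + _); apply:
    esym; exact: pbd.
have Hcd i j : V false false i j + V false true i j + V true false i j + V true true i j
  = 5.
  by rewrite -(tcov2 (apart_flip i j dc)) (quad _ a b); congr (_ + _ + _ + _); apply:
    esym; exact: pcd.
move: (Hab false false) (Hab false true) (Hab true false) (Hab true true).
move: (Hac false false) (Hac false true) (Hac true false) (Hac true true).
move: (Had false false) (Had false true) (Had true false) (Had true true).
move: (Hbc false false) (Hbc false true) (Hbc true false) (Hbc true true).
move: (Hbd false false) (Hbd false true) (Hbd true false) (Hbd true true).
move: (Hcd false false) (Hcd false true) (Hcd true false) (Hcd true true).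
move: (V_gt0 false false false false) (V_gt0 false false false true) (V_gt0 false false
  true false) (V_gt0 false false true true) (V_gt0 false true false false) (V_gt0 false
  true false true) (V_gt0 false true true false) (V_gt0 false true true true) (V_gt0
  true false false false) (V_gt0 true false false true) (V_gt0 true false true false)
  (V_gt0 true false true true) (V_gt0 true true false false) (V_gt0 true true false
  true) (V_gt0 true true true false) (V_gt0 true true true true).
clear; move: (V false false false false) (V false false false true) (V false false true
  false) (V false false true true) (V false true false false) (V false true false true)
  (V false true true false) (V false true true true) (V true false false false) (V true
  false false true) (V true false true false) (V true false true true) (V true true
  false false) (V true true false true) (V true true true false) (V true true true
  true).
(* Four positive integers with sum 5 are one 2 and three 1s. Four parallel 2-faces thus give four
   places with value 2, no two on a common 2-face: binary words of length 4 at pairwise distance at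
   least 3. Three such words are already impossible, since their distances add up to at most 2 * 4 <
   9. *)
clear; lia.
Qed.

End Partner.

End Design.

(** * The lower bound 41 and a covering that attains it *)

Lemma covering_ge41 (T : finType) (B : {set {set T}}) : is_covering 12 6 4 B -> 41 <=
  #|B|.
Proof.
case/and3P => /eqP card12 /forall_inP Bk /forallP Bt; rewrite ltnNge; apply/negP =>
  le40.
have card_block : {in enum B, forall b : {set T}, #|b| = 6}.
  by move=> b; rewrite mem_enum => /Bk/eqP.
have coverB (s : seq T) : size s = 4 -> uniq s -> has (inside s) (enum B).
  move=> s4 us; have := Bt [set:: s].
  have -> : #|[set:: s]| == 4 by rewrite -s4 -(card_uniqP us) cardsE.
  case/exists_inP => b bB /subsetP sb; apply/hasP; exists b; first by rewrite mem_enum.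
  by apply/allP => z zs; apply: sb; rewrite inE.
rewrite cardE in le40.
have [f fP] := fin_all_exists (partner_exists card12 card_block coverB le40).
exact: (no_forty card12 card_block coverB le40 fP).
Qed.

(* The unions of three of the pairs {2i, 2i+1}, and the transversals given by the
   binary expansions of the numbers below 64 congruent to 2 modulo 3, which form
   a covering array of strength 4. *)
Definition rows : seq (seq nat) :=
  [seq flatten [seq [:: i.*2; i.*2.+1] | i <- iota 0 6 & nth false m i] | m <- words 6
    3]
  ++ [seq [seq i.*2 + odd ((3 * q + 2) %/ 2 ^ i) | i <- iota 0 6] | q <- iota 0 21].

(** Four points that include a pair meet at most three pairs and lie in a union of three. Otherwise
    four binary digits are prescribed, and the two free ones, of weight 1 or 2 modulo 3, reach every
    residue. Residue 2 occurs 21 times below 64, whereas residue 0 would cost 22 rows. *)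
Lemma rows_ok :
  [&& size rows == 41, all (fun r => count [in r] (iota 0 12) == 6) rows &
      all (fun m => has (fun r => all (fun i => nth false m i ==> (i \in r)) (iota 0
        12)) rows) (words 12 4)].
Proof. exact_no_check (erefl true). Qed.

Definition row_set (r : seq nat) : {set 'I_12} := [set i : 'I_12 | val i \in r].

Lemma rows_covering : is_covering 12 6 4 [set b in map row_set rows].
Proof.
have /and3P[_ /allP r6 /allP rc] := rows_ok.
have count_ord (P : pred nat) : count P (iota 0 12) = #|[set i : 'I_12 | P i]|.
  by rewrite -val_enum_ord count_map count_enum cardsE.
apply/and3P; split; first by rewrite card_ord.
  by apply/forall_inP => b; rewrite inE => /mapP[r /r6 + ->]; rewrite count_ord.
apply/forallP => S; apply/implyP => /eqP cS.
have := rc [seq i \in S | i <- enum 'I_12] _.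
have -> : [seq i \in S | i <- enum 'I_12] \in words 12 4.
  have := words_mem [seq i \in S | i <- enum 'I_12].
  by rewrite size_map size_enum_ord count_map count_enum cS.
case/(_ isT)/hasP => r rr /allP h; apply/exists_inP; exists (row_set r).
  by rewrite inE map_f.
apply/subsetP => i iS; rewrite inE; have := h i.
rewrite mem_iota ltn_ord => /(_ isT)/implyP; apply.
by rewrite (nth_map i) ?size_enum_ord // nth_ord_enum.
Qed.

Theorem theorem1 :
  covering_number 12 6 4 = 41 /\
  ~ (exists (X : finType) (B : {set {set X}}),
       is_covering 12 6 4 B /\ #|B| = 40).
Proof.
have cn : covering_number 12 6 4 = 41.
  apply/eqP; rewrite eqn_leq; apply/andP; split.
    apply: leq_trans (covering_number_le _ rows_covering) _; rewrite // cardsE.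
    apply: leq_trans (card_size _) _; rewrite size_map.
    by have /and3P[/eqP -> _ _] := rows_ok.
  by have [B /covering_ge41 ? <-] := @covering_number_attained 12 6 4 isT.
split=> // -[X [B [cB cB40]]].
by have := @covering_number_le 12 6 4 X B isT cB; rewrite cn cB40.
Qed.
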